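(* Let $\underline T=(T_1,\dots,T_d)$ be a commuting tuple of contractions on a Hilbert space $\mathcal H$ and let $(\mathfrak J,\mathcal K,\underline U)$ be its canonical unitary pseudo-extension. Then every $X\in\mathcal B(\mathcal H)$ in the commutant of $\underline T$ has a pseudo-extension through $\mathfrak J$ to an operator $Y\in\mathcal B(\mathcal K)$ in the commutant of $\underline U$, i.e., there is $Y\in\mathcal B(\mathcal K)$ with $YU_j=U_jY$ for all $j$ and $\mathfrak JX=Y\mathfrak J$, such that $\|Y\|\le\|X\|$.
   Context: Hilbert spaces are complex; operators are bounded and linear. The commutant of a tuple is the set of bounded operators commuting with each of its entries. The product contraction of $\underline T$ is $P=T_1T_2\cdots T_d$. A pseudo-extension of a $d$-tuple $\underline T$ of commuting bounded operators on $\mathcal H$ is a triple $(\mathfrak J,\mathcal K,\underline U)$ where $\mathcal K$ is a Hilbert space, $\underline U=(U_1,\dots,U_d)$ is a $d$-tuple of commuting bounded operators on $\mathcal K$, and $\mathfrak J:\mathcal H\to\mathcal K$ is a non-zero contraction with $\mathfrak J T_j=U_j\mathfrak J$ for every $j$. It is unitary if every $U_j$ is unitary. It is minimal if $\mathcal K$ is the smallest closed subspace reducing each $U_j$ and containing $\mathfrak J\mathcal H$. A minimal pseudo-extension of a tuple of commuting contractions is canonical if $\mathfrak J^*\mathfrak J=\operatorname{SOT-}\lim_{n\to\infty}P^{*n}P^n$. (Canonical unitary pseudo-extensions are unique up to unitary equivalence, i.e., up to a unitary $W$ between the spaces intertwining the tuples and satisfying $W\mathfrak J=\tilde{\mathfrak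 J}$.) *)

(* Defs.v *)
From HB Require Import structures.
From mathcomp Require Import all_boot all_order all_algebra.
From mathcomp Require Import complex.
From mathcomp Require Import boolp classical_sets functions reals topology.
From mathcomp Require Import normedtype sequences.

Set Implicit Arguments.
Unset Strict Implicit.
Unset Printing Implicit Defensive.

Import Order.TTheory GRing.Theory Num.Theory.
Import numFieldNormedType.Exports.

Local Open Scope classical_set_scope.
Local Open Scope ring_scope.
Local Open Scope complex_scope.

(* [hdot] is linear in its first argument and conjugate-linear in its second. *)
HB.mixin Record isHilbert (R : realType) (H : Type)
    of CompleteNormedModule R[i] H := {
  hdot : {dot H for (@Num.conj R[i])} ;
  hdot_norm : forall x : H, hdot x x = `|x| ^+ 2
}.

#[short(type="hilbertType")]
HB.structure Definition Hilbert (R : realType) :=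
  {H of isHilbert R H & CompleteNormedModule R[i] H}.

Section Operators.
Variable R : realType.
Implicit Types H K : hilbertType R.

Definition bounded_op H K (A : {linear H -> K}) : Prop :=
  exists M : R, forall x : H, `|A x| <= M%:C * `|x|.

(* Norms take values in R[i], hence the real part. *)
Definition opnorm H K (A : {linear H -> K}) : R :=
  sup [set complex.Re `|A x| | x in [set x : H | `|x| <= 1]].

Definition contractive_op H K (A : {linear H -> K}) : Prop :=
  bounded_op A /\ opnorm A <= 1.

(* The value at [y] is the Riesz representative of [fun x => hdot (A x) y];
   it is meaningful when [A] is linear and bounded. *)
Definition adjoint H K (A : H -> K) : K -> H := fun y =>
  xget 0 [set z : H | forall x : H, hdot (A x) y = hdot x z].

Definition unitary_op H (A : {linear H -> H}) : Prop :=
  [/\ bounded_op A, adjoint A \o A = idfun & A \o adjoint A = idfun].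

Definition closed_subspace H (M : set H) : Prop :=
  [/\ closed M, M 0 & forall (a : R[i]) (x y : H), M x -> M y -> M (a *: x + y)].

Definition orthocompl H (M : set H) : set H :=
  [set x | forall y, M y -> hdot x y = 0].

Definition reduces H (M : set H) (A : {linear H -> H}) : Prop :=
  A @` M `<=` M /\ A @` orthocompl M `<=` orthocompl M.

Definition sot_cvg H K (A : nat -> H -> K) (B : H -> K) : Prop :=
  forall x : H, (A n x) @[n --> \oo] --> B x.

Variable d : nat.

Definition commuting_tuple H (T : 'I_d -> {linear H -> H}) : Prop :=
  (forall j, bounded_op (T j)) /\ (forall i j, T i \o T j = T j \o T i).

Definition commutant H (T : 'I_d -> {linear H -> H}) (X : {linear H -> H}) :
    Prop :=
  bounded_op X /\ forall j, X \o T j = T j \o X.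

Definition product_op H (T : 'I_d -> {linear H -> H}) : H -> H :=
  \big[(fun A B : H -> H => A \o B)/idfun]_(j < d) (T j : H -> H).

Definition pseudo_extension H K (T : 'I_d -> {linear H -> H})
    (J : {linear H -> K}) (U : 'I_d -> {linear K -> K}) : Prop :=
  [/\ commuting_tuple U, contractive_op J, (exists h, J h != 0)
    & forall j, J \o T j = U j \o J].

(* Since the whole space is a closed reducing subspace, it is the smallest one
   with the given properties iff it is the only one. *)
Definition minimal_pseudo_extension H K (T : 'I_d -> {linear H -> H})
    (J : {linear H -> K}) (U : 'I_d -> {linear K -> K}) : Prop :=
  pseudo_extension T J U /\
  forall M : set K, closed_subspace M -> (forall j, reduces M (U j)) ->
    range J `<=` M -> M = setT.

Definition canonical_pseudo_extension H K (T : 'I_d -> {linear H -> H})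
    (J : {linear H -> K}) (U : 'I_d -> {linear K -> K}) : Prop :=
  minimal_pseudo_extension T J U /\
  sot_cvg
    (fun n => iter n (adjoint (product_op T)) \o iter n (product_op T))
    (adjoint J \o J).

Definition canonical_unitary_pseudo_extension H K (T : 'I_d -> {linear H -> H})
    (J : {linear H -> K}) (U : 'I_d -> {linear K -> K}) : Prop :=
  canonical_pseudo_extension T J U /\ forall j, unitary_op (U j).

End Operators.

(* Main.v *)
From HB Require Import structures.
Require Import Defs.
From mathcomp Require Import all_boot all_order all_algebra.
From mathcomp Require Import complex reals topology normedtype.
From mathcomp Require Import boolp classical_sets functions sequences.
From mathcomp Require Import interval_inference.
From mathcomp Require Import ring lra.

Local Open Scope ring_scope.

Set Implicit Arguments.
Unset Strict Implicit.
Unset Printing Implicit Defensive.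

Import Order.TTheory GRing.Theory Num.Theory.
Import numFieldNormedType.Exports.

Local Open Scope classical_set_scope.
Local Open Scope complex_scope.

(** Proof idea. Let [P] be the product contraction. Since [J^* J] is the strong
    limit of [P^*n P^n], the norm of [J h] is the limit of the norms of [P^n h].
    An operator [X] commuting with every [T_j] commutes with [P], so that
    [|P^n X h| <= |X| |P^n h|], and in the limit [|J X h| <= |X| |J h|]
    ([canonical_commutant_le]).  Hence [J h |-> J X h] is well defined and
    bounded by [|X|] on the range of [J].

    To go from the range of [J] to [K], use finite products [U_w] of the
    unitaries, indexed by words [w].  The vectors [k] such that [U_w k = J h]
    for some [w] and [h] form a linear subspace, because the intertwining
    [J T_w = U_w J] lets two words be replaced by their concatenation.  This
    subspace contains the range of [J] and is invariant under each [U_j] and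
    its adjoint, so its closure is reducing, and minimality makes it dense
    ([minimal_dense]).  On it [Y] is forced to be the map sending [k] to the
    [k'] with [U_w k' = J X h]; as [U_w] is an isometry, this map is bounded by
    [|X|], and it commutes with each [U_j].  It extends by continuity
    ([extend_linear_relation]) to the operator [Y] on [K].

    The adjoint is characterised by its defining identity only when a Riesz
    representative exists, which is established by minimising
    [|x|^2 - 2 f x] ([riesz_real], [adjointP]). *)

(** * The real inner product space underlying a Hilbert space *)

(** Norms take values in [R[i]]; all estimates are carried out on their real
    parts, where the order is total. *)
Section RealForm.
Variables (R : realType) (H : hilbertType R).
Implicit Types (x y z : H) (t e : R).

Definition rnorm x : R := complex.Re `|x|.
Definition rdot x y : R := complex.Re (hdot x y).

Lemma rnormE x : `|x| = (rnorm x)%:C.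
Proof. by rewrite /rnorm RRe_real// normr_real. Qed.

Lemma rnorm_ge0 x : 0 <= rnorm x.
Proof. by rewrite -ler0c -rnormE. Qed.

Lemma rnorm0_eq0 x : rnorm x = 0 -> x = 0.
Proof. by move=> x0; apply/normr0_eq0; rewrite rnormE x0. Qed.

Lemma rnorm0 : rnorm 0 = 0.
Proof. by rewrite /rnorm normr0. Qed.

Lemma rnormN x : rnorm (- x) = rnorm x.
Proof. by rewrite /rnorm normrN. Qed.

Lemma rdistC x y : rnorm (x - y) = rnorm (y - x).
Proof. by rewrite -opprB rnormN. Qed.

Lemma rnormD x y : rnorm (x + y) <= rnorm x + rnorm y.
Proof. by rewrite -lecR rmorphD /= -!rnormE ler_normD. Qed.

Lemma rnormZ (a : R[i]) x : rnorm (a *: x) = complex.Re `|a| * rnorm x.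
Proof.
by rewrite /rnorm normrZ (rnormE x) normc_def -rmorphM.
Qed.

Lemma rnormZr t x : 0 <= t -> rnorm (t%:C *: x) = t * rnorm x.
Proof. by move=> t0; rewrite rnormZ ger0_norm ?ler0c. Qed.

Lemma rnorm_triangle y x z : rnorm (x - z) <= rnorm (x - y) + rnorm (y - z).
Proof. by apply: le_trans _ (rnormD _ _); rewrite addrA subrK. Qed.

Lemma rdotC x y : rdot x y = rdot y x.
Proof. by rewrite /rdot hermC expr0 mul1r /=; case: (hdot y x : R[i]). Qed.

Lemma rdotDl x y z : rdot (x + y) z = rdot x z + rdot y z.
Proof.
have -> : rdot x z + rdot y z = complex.Re (hdot x z + hdot y z).
  by rewrite /rdot; case: (hdot x z) (hdot y z) => a b [].
by rewrite -linearDl.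
Qed.

Lemma rdotNl x z : rdot (- x) z = - rdot x z.
Proof.
have -> : - rdot x z = complex.Re (- hdot x z).
  by rewrite /rdot; case: (hdot x z).
by rewrite -linearNl.
Qed.

Lemma hdotZl (a : R[i]) x z : hdot (a *: x) z = a * hdot x z.
Proof. exact: linearZl_LR. Qed.

Lemma rdotZl t x z : rdot (t%:C *: x) z = t * rdot x z.
Proof.
rewrite /rdot hdotZl; case: (hdot x z) => a b /=.
by rewrite mul0r subr0.
Qed.

Lemma rdotDr x y z : rdot z (x + y) = rdot z x + rdot z y.
Proof. by rewrite rdotC rdotDl !(rdotC z). Qed.

Lemma rdotNr x z : rdot z (- x) = - rdot z x.
Proof. by rewrite rdotC rdotNl !(rdotC z). Qed.

Lemma rdotZr t x z : rdot z (t%:C *: x) = t * rdot z x.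
Proof. by rewrite rdotC rdotZl !(rdotC z). Qed.

Lemma rdotxx x : rdot x x = rnorm x ^+ 2.
Proof. by rewrite /rdot hdot_norm rnormE -rmorphXn. Qed.

Lemma Im_hdot x y : complex.Im (hdot x y) = - rdot ('i *: x) y.
Proof.
by rewrite /rdot hdotZl; case: (hdot x y) => a b /=; ring.
Qed.

Lemma sqr_rnormD x y :
  rnorm (x + y) ^+ 2 = rnorm x ^+ 2 + 2 * rdot x y + rnorm y ^+ 2.
Proof. by rewrite -!rdotxx rdotDl !rdotDr (rdotC y x); ring. Qed.

Lemma sqr_rnormB x y :
  rnorm (x - y) ^+ 2 = rnorm x ^+ 2 - 2 * rdot x y + rnorm y ^+ 2.
Proof. by rewrite sqr_rnormD rnormN rdotNr; ring. Qed.

(** Cauchy-Schwarz, obtained by expanding the square of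
    [|y| x - |x| y]. *)
Lemma rdot_le x y : rdot x y <= rnorm x * rnorm y.
Proof.
have [x0|xn0] := eqVneq (rnorm x) 0.
  by rewrite (rnorm0_eq0 x0) /rdot linear0l rnorm0 mul0r.
have [y0|yn0] := eqVneq (rnorm y) 0.
  by rewrite (rnorm0_eq0 y0) /rdot linear0r rnorm0 mulr0.
have xp : 0 < rnorm x by rewrite lt_neqAle eq_sym xn0 rnorm_ge0.
have yp : 0 < rnorm y by rewrite lt_neqAle eq_sym yn0 rnorm_ge0.
have := sqr_rnormB ((rnorm y)%:C *: x) ((rnorm x)%:C *: y).
rewrite !rnormZr ?rnorm_ge0// rdotZl rdotZr => E.
have := sqr_ge0 (rnorm ((rnorm y)%:C *: x - (rnorm x)%:C *: y)).
rewrite E => {}E; rewrite -subr_ge0 -(pmulr_rge0 _ xp) -(pmulr_rge0 _ yp).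
lra.
Qed.

Lemma rdot_abs_le x y : `|rdot x y| <= rnorm x * rnorm y.
Proof.
by rewrite ler_norml rdot_le andbT lerNl -rdotNr -(rnormN y) rdot_le.
Qed.

(** A form of completeness that avoids choosing sequences: if the points
    determined up to precision [e] are pairwise close, then they approximate
    one limit point, with the same precision. *)
Lemma hilbert_complete (A : R -> set H) :
  (forall e, 0 < e -> A e !=set0) ->
  (forall e e' x y, 0 < e -> 0 < e' -> A e x -> A e' y ->
    rnorm (x - y) <= e + e') ->
  exists l, forall e x, 0 < e -> A e x -> rnorm (x - l) <= e.
Proof.
move=> A0 Acl.
have inv_gt0 n : (0 : R) < n.+1%:R^-1 by rewrite invr_gt0 ltr0n.
have [u uA] := choice (fun n => A0 _ (inv_gt0 n)).
have near_small (e : R) : 0 < e -> \forall n \near \oo, n.+1%:R^-1 < e.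
  by move=> e0; exact: near_infty_natSinv_lt (PosNum e0).
have /cauchy_cvgP/cvg_ex[l ul] : cauchy (u @ \oo).
  apply: cauchy_exP => eps eps0.
  have epsE : eps = (complex.Re eps)%:C by rewrite RRe_real// gtr0_real.
  move: (complex.Re eps) epsE eps0 => e -> {eps}; rewrite ltcR => e0.
  have e20 : 0 < e / 2 by rewrite divr_gt0.
  have [N _ Nsmall] := near_small _ e20.
  exists (u N), N => // n /= Nn.
  rewrite -ball_normE /= rnormE ltcR.
  apply: le_lt_trans (Acl _ _ _ _ (inv_gt0 N) (inv_gt0 n) (uA N) (uA n)) _.
  by rewrite (splitr e) ltrD//; apply: Nsmall => /=.
exists l => e x e0 xA; apply/ler_addgt0Pr => d d0.
have d20 : 0 < d / 2 by rewrite divr_gt0.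
have : \forall n \near \oo, `|u n - l| < (d / 2)%:C.
  by move/cvgrPdistC_lt : ul; apply; rewrite ltcR.
move=> /(filterI (near_small _ d20)) /filter_ex[n /= [nd]].
rewrite rnormE ltcR => ul2.
apply: le_trans (rnorm_triangle (u n) _ _) _.
rewrite (splitr d) addrA lerD ?(ltW ul2)//.
apply: le_trans (Acl _ _ _ _ e0 (inv_gt0 n) xA (uA n)) _.
by rewrite lerD2l ltW.
Qed.

End RealForm.
(** * Riesz representation and adjoints *)

Lemma le0_of_small (R : realType) (a C : R) :
  (forall e, 0 < e -> a <= e * C) -> a <= 0.
Proof.
move=> small; rewrite leNgt; apply/negP => a0.
have C0 : 0 < C by apply: lt_le_trans a0 _; rewrite -(mul1r C) small.
have := small (a / (2 * C)) (divr_gt0 a0 (mulr_gt0 (ltr0Sn _ 1) C0)).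
have -> : a / (2 * C) * C = a / 2 by field; rewrite gt_eqF.
lra.
Qed.

Section Riesz.
Variables (R : realType) (H : hilbertType R) (f : H -> R) (c : R).
Hypothesis fD : forall x y, f (x + y) = f x + f y.
Hypothesis fZ : forall (t : R) x, f (t%:C *: x) = t * f x.
Hypothesis f_le : forall x, f x <= c * rnorm x.

Let F (x : H) : R := rnorm x ^+ 2 - 2 * f x.

(** The representative of [f] is the minimiser of [F x = |x|^2 - 2 f x].  By the
    parallelogram law near-minimisers are close to each other, so they converge
    to some [z]; comparing [F w] with [F (w + e x)] for a near-minimiser [w]
    shows that [f] and the inner product with [z] agree. *)
Lemma riesz_real : exists z, forall x, f x = rdot x z.
Proof.
have Fge x : - c ^+ 2 <= F x.
  have := f_le x; have := sqr_ge0 (rnorm x - c); rewrite /F; nra.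
have Finf : has_inf (range F).
  by split; [exists (F 0), 0|exists (- c ^+ 2) => _ [x _ <-]; exact: Fge].
set m := inf (range F).
have mF x : m <= F x by apply: ge_inf; [exact: Finf.2|exists x].
have parallelogram x y :
    rnorm (x - y) ^+ 2 <= 2 * (F x - m) + 2 * (F y - m).
  have := mF ((2^-1)%:C *: (x + y)).
  rewrite /F fZ fD rnormZr ?invr_ge0// exprMn sqr_rnormD sqr_rnormB.
  lra.
have [||z zP] := @hilbert_complete R H
  (fun e => [set x | F x <= m + e ^+ 2 / 2]).
- move=> e e0.
  have [|_ [x _ <-] Fx] := @inf_adherent _ (range F) (e ^+ 2 / 2) _ Finf.
    by rewrite divr_gt0// exprn_gt0.
  by exists x; exact: ltW.
- move=> e e' x y e0 e'0 /= Fx Fy.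
  rewrite -ler_sqr ?nnegrE ?rnorm_ge0 ?(addr_ge0 (ltW e0) (ltW e'0))//.
  apply: le_trans (parallelogram x y) _.
  have := mulr_gt0 e0 e'0; lra.
exists z.
(* One inequality suffices, as both sides are odd in [x]. *)
suff half x : f x - rdot x z <= 0.
  move=> x; apply/eqP; rewrite eq_le -subr_le0 half /= -subr_le0.
  have := half ((-1)%:C *: x); rewrite fZ rdotZl; lra.
apply: (@le0_of_small R _ (rnorm x ^+ 2 / 2 + 1 / 4 + rnorm x)) => e e0.
have [|_ [w _ <-] Fw] := @inf_adherent _ (range F) (e ^+ 2 / 2) _ Finf.
  by rewrite divr_gt0// exprn_gt0.
have wz := zP _ _ e0 (ltW Fw).
(* A step of length [e] is compatible with the precision [e ^+ 2 / 2] of [w]: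
   dividing by [e] leaves an error of order [e]. *)
have := mF (w + e%:C *: x).
rewrite /F sqr_rnormD rnormZr ?(ltW e0)// fD fZ rdotZr => Fwx.
have D : f x - rdot x w <= e * (rnorm x ^+ 2 / 2 + 1 / 4).
  rewrite -(ler_pM2l e0); move: Fw Fwx; rewrite -/m /F (rdotC x w) exprMn; lra.
have : rdot x (w - z) <= rnorm x * e.
  by apply: le_trans (rdot_le _ _) _; rewrite ler_wpM2l ?rnorm_ge0.
rewrite rdotDr rdotNr; lra.
Qed.

End Riesz.

Section BoundedOperators.
Variables (R : realType).
Implicit Types H K : hilbertType R.

Lemma bounded_opP H K (A : {linear H -> K}) :
  bounded_op A <-> exists M, forall x, rnorm (A x) <= M * rnorm x.
Proof.
by split=> -[M AM]; exists M => x; have := AM x;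
  rewrite !rnormE -rmorphM lecR.
Qed.

Lemma opnorm_has_sup H K (A : {linear H -> K}) : bounded_op A ->
  has_sup [set complex.Re `|A x| | x in [set x : H | `|x| <= 1]].
Proof.
move=> /bounded_opP[M AM]; split.
  by exists (rnorm (A 0)), 0; rewrite //= normr0.
exists `|M| => _ [x /= x1 <-]; apply: le_trans (AM x) _.
move: x1; rewrite rnormE -(rmorph1 (real_complex R)) lecR => x1.
apply: le_trans (ler_norm _) _.
by rewrite normrM (ger0_norm (rnorm_ge0 x)) ler_piMr.
Qed.

Lemma opnorm_ge0 H K (A : {linear H -> K}) : bounded_op A -> 0 <= opnorm A.
Proof.
move=> Ab; apply: le_trans (rnorm_ge0 (A 0)) _.
apply: ub_le_sup; first exact: (opnorm_has_sup Ab).2.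
by exists 0; rewrite //= normr0.
Qed.

Lemma le_opnorm H K (A : {linear H -> K}) x :
  bounded_op A -> rnorm (A x) <= opnorm A * rnorm x.
Proof.
move=> Ab; have [x0|xn0] := eqVneq (rnorm x) 0.
  by rewrite (rnorm0_eq0 x0) linear0 !rnorm0 mulr0.
have xp : 0 < rnorm x by rewrite lt_neqAle eq_sym xn0 rnorm_ge0.
have Vp : 0 <= (rnorm x)^-1 by rewrite invr_ge0 ltW.
rewrite -ler_pdivrMr// mulrC -rnormZr// -linearZ.
apply: ub_le_sup; first exact: (opnorm_has_sup Ab).2.
exists ((rnorm x)^-1%:C *: x) => //=.
by rewrite rnormE rnormZr// mulVf.
Qed.

Lemma opnorm_le H K (A : {linear H -> K}) (c : R) : 0 <= c ->
  (forall x, rnorm (A x) <= c * rnorm x) -> opnorm A <= c.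
Proof.
move=> c0 Ac; apply: ge_sup.
  by exists (rnorm (A 0)), 0; rewrite //= normr0.
move=> _ [x /= + <-]; rewrite rnormE -(rmorph1 (real_complex R)) lecR => x1.
by apply: le_trans (Ac x) _; rewrite ler_piMr.
Qed.

(** [riesz_real] represents the real part of [fun x => hdot (A x) y]; the
    imaginary part follows by replacing [x] with ['i *: x]. *)
Lemma adjointP H K (A : {linear H -> K}) x y :
  bounded_op A -> hdot (A x) y = hdot x (adjoint A y).
Proof.
move=> /bounded_opP[M AM].
have M'M x' : rdot (A x') y <= M * rnorm y * rnorm x'.
  apply: le_trans (rdot_le _ _) _; rewrite mulrAC ler_wpM2r ?rnorm_ge0//.
have [|t x'|z zP] :=
  @riesz_real R H (fun x => rdot (A x) y) (M * rnorm y) _ _ M'M.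
- by move=> u v; rewrite linearD rdotDl.
- by rewrite linearZ rdotZl.
suff : [set z | forall x, hdot (A x) y = hdot x z] (adjoint A y) by exact.
apply: xgetPex; exists z => {}x.
apply/eqP; rewrite eq_complex; apply/andP; split; apply/eqP; first exact: zP.
by rewrite !Im_hdot -linearZ zP.
Qed.

Lemma rdot_adjoint H K (A : {linear H -> K}) x y :
  bounded_op A -> rdot (A x) y = rdot x (adjoint A y).
Proof. by move=> Ab; rewrite /rdot adjointP. Qed.

Lemma unitary_isometric H (U : {linear H -> H}) x :
  unitary_op U -> rnorm (U x) = rnorm x.
Proof.
case=> Ub UsU _; apply/eqP; rewrite -(@eqrXn2 _ 2) ?rnorm_ge0//.
by rewrite -!rdotxx rdot_adjoint// -[adjoint U (U x)]/((adjoint U \o U) x) UsU.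
Qed.

(** * Density and extension by continuity *)

Definition dense H (D : set H) : Prop :=
  forall x (e : R), 0 < e -> exists2 x', D x' & rnorm (x' - x) < e.

Lemma eq_on_dense H K (A B : {linear H -> K}) (D : set H) :
  bounded_op A -> bounded_op B -> dense D -> (forall x, D x -> A x = B x) ->
  forall x, A x = B x.
Proof.
move=> /bounded_opP[M AM] /bounded_opP[N BN] Dd AB x.
apply/eqP; rewrite -subr_eq0; apply/eqP/rnorm0_eq0/eqP.
rewrite eq_le rnorm_ge0 andbT.
apply: (@le0_of_small R _ (`|M| + `|N|)) => e e0.
have [x' Dx' xx'] := Dd x e e0.
have -> : A x - B x = A (x - x') + B (x' - x).
  by rewrite !linearB (AB x' Dx') addrA subrK.
apply: le_trans (rnormD _ _) _; rewrite mulrDr lerD//.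
  apply: le_trans (AM _) _; rewrite rdistC mulrC.
  apply: le_trans (ler_wpM2l (rnorm_ge0 _) (ler_norm M)) _.
  by rewrite ler_wpM2r// ltW.
apply: le_trans (BN _) _; rewrite mulrC.
apply: le_trans (ler_wpM2l (rnorm_ge0 _) (ler_norm N)) _.
by rewrite ler_wpM2r// ltW.
Qed.

(** Extension by continuity of a densely defined bounded linear map.  The map is
    given by its graph [G]; the bound, applied to differences, makes [G]
    single-valued. *)
Lemma extend_linear_relation H K (G : H -> K -> Prop) (c : R) :
  0 <= c ->
  (forall (a : R[i]) x x' y y',
    G x y -> G x' y' -> G (a *: x + x') (a *: y + y')) ->
  (forall x y, G x y -> rnorm y <= c * rnorm x) ->
  dense [set x | exists y, G x y] ->
  exists Y : {linear H -> K}, (forall x y, G x y -> Y x = y) /\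
    forall x, rnorm (Y x) <= c * rnorm x.
Proof.
move=> c0 Glin Gc Gd.
have GB x x' y y' : G x y -> G x' y' -> rnorm (y' - y) <= c * rnorm (x' - x).
  move=> Gxy Gxy'; have := Glin (-1) _ _ _ _ Gxy Gxy'.
  by rewrite !scaleN1r ![- _ + _]addrC; exact: Gc.
have value x : exists l, forall x' y', G x' y' ->
    rnorm (y' - l) <= c * rnorm (x' - x).
  have [||l lP] := @hilbert_complete R K
    (fun e => [set y | exists2 x', G x' y & c * rnorm (x' - x) <= e]).
  - move=> e e0; have [|x' [y Gxy] x'x] := Gd x (e / (c + 1)).
      by rewrite divr_gt0// ltr_wpDl.
    exists y, x' => //; move: x'x; rewrite ltr_pdivlMr ?ltr_wpDl//.
    have := rnorm_ge0 (x' - x); lra.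
  - move=> e e' y y' _ _ [x1 G1 xe] [x2 G2 xe'].
    apply: le_trans (GB _ _ _ _ G2 G1) _; apply: le_trans (lerD xe xe').
    by rewrite -mulrDr ler_wpM2l// (rdistC x2) rnorm_triangle.
  (* The slack [d] keeps the precision positive when [x' = x]. *)
  exists l => x' y' Gxy; apply/ler_addgt0Pr => d d0; apply: lP.
    by rewrite ltr_wpDl// mulr_ge0// rnorm_ge0.
  by exists x'; rewrite // lerDl ltW.
(* The estimate [YP] characterises [Y] and makes linearity, the bound and the
   agreement with [G] consequences of approximation within [e]. *)
have [Y YP] := choice value.
have Ylin : linear Y.
  move=> a x1 x2; apply/eqP; rewrite -subr_eq0; apply/eqP/rnorm0_eq0/eqP.
  rewrite eq_le rnorm_ge0 andbT.
  apply: (@le0_of_small R _ (2 * c * (complex.Re `|a| + 1))) => e e0.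
  have [p1 [q1 G1] pe1] := Gd x1 e e0; have [p2 [q2 G2] pe2] := Gd x2 e e0.
  have a0 : 0 <= complex.Re `|a| by rewrite -ler0c RRe_real ?normr_real.
  have E1 := YP x1 _ _ G1; have E2 := YP x2 _ _ G2.
  have := YP (a *: x1 + x2) _ _ (Glin a _ _ _ _ G1 G2).
  rewrite (_ : a *: p1 + p2 - _ = a *: (p1 - x1) + (p2 - x2)); last first.
    by rewrite scalerBr opprD addrACA.
  have := rnormD (a *: (p1 - x1)) (p2 - x2); rewrite rnormZ => E3 E4.
  have -> : Y (a *: x1 + x2) - (a *: Y x1 + Y x2) =
      (Y (a *: x1 + x2) - (a *: q1 + q2)) + (a *: (q1 - Y x1) + (q2 - Y x2)).
    by rewrite scalerBr [a *: q1 - _ + _]addrACA -opprD addrA subrK.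
  apply: le_trans (rnormD _ _) _; rewrite rdistC.
  apply: le_trans (lerD E4 (rnormD _ _)) _; rewrite rnormZ.
  have F1 := ler_wpM2l a0 E1.
  have F2 := ler_wpM2l c0 E3.
  have F3 := ler_wpM2l c0 (ltW pe2).
  have F4 := ler_wpM2l (mulr_ge0 c0 a0) (ltW pe1).
  lra.
pose Ymix := GRing.isLinear.Build R[i] H K *:%R Y Ylin.
pose YL : {linear H -> K} := HB.pack Y Ymix.
exists YL; split=> [x y Gxy|x]; rewrite /=.
  apply/eqP; rewrite eq_sym -subr_eq0; apply/eqP/rnorm0_eq0/eqP.
  rewrite eq_le rnorm_ge0 andbT.
  by have := YP x _ _ Gxy; rewrite subrr rnorm0 mulr0.
rewrite -subr_le0; apply: (@le0_of_small R _ (2 * c)) => e e0.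
have [p [q Gpq] pe] := Gd x e e0.
have E1 := YP x _ _ Gpq; have E2 := Gc _ _ Gpq.
have := rnormD q (- (q - Y x)); rewrite rnormN opprB addrC subrK => E3.
have := rnormD (p - x) x; rewrite subrK => E4.
have := ler_wpM2l c0 E4; have := ler_wpM2l c0 (ltW pe); lra.
Qed.

Lemma closure_rnormP H (D : set H) x :
  closure D x <-> forall e, 0 < e -> exists2 x', D x' & rnorm (x' - x) < e.
Proof.
split=> [Dx e e0|Dx B].
  have [|x' [Dx' /=]] := Dx (ball x e%:C).
    by apply: nbhsx_ballx; rewrite ltcR.
  by rewrite -ball_normE /= rnormE ltcR rdistC; exists x'.
move=> /nbhs_ballP[e /= e0 eB].
have eE : e = (complex.Re e)%:C by rewrite RRe_real// gtr0_real.
move: e0 eB; rewrite eE ltcR => e0 eB.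
have [x' Dx' xx'] := Dx _ e0; exists x'; split=> //; apply: eB.
by rewrite -ball_normE /= rnormE ltcR rdistC.
Qed.

End BoundedOperators.
(** * Words in a tuple of operators *)

Section Words.
Variables (R : realType) (d : nat).
Implicit Types (H K : hilbertType R) (w v : seq 'I_d).

Definition word_op H (T : 'I_d -> {linear H -> H}) w (x : H) : H :=
  foldr (fun j y => T j y) x w.

Lemma word_op_linear H (T : 'I_d -> {linear H -> H}) w : linear (word_op T w).
Proof. by move=> a x y; elim: w => //= j w ->; rewrite linearP. Qed.

Lemma word_op_intertwine H K (T : 'I_d -> {linear H -> H})
    (U : 'I_d -> {linear K -> K}) (f : H -> K) w x :
  (forall j x, f (T j x) = U j (f x)) ->
  f (word_op T w x) = word_op U w (f x).
Proof. by move=> fTU; elim: w => //= j w <-; rewrite fTU. Qed.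

Lemma word_op_cat H (T : 'I_d -> {linear H -> H}) w v x :
  word_op T (w ++ v) x = word_op T w (word_op T v x).
Proof. exact: foldr_cat. Qed.

Lemma word_op_isometric H (U : 'I_d -> {linear H -> H}) w x :
  (forall j, unitary_op (U j)) -> rnorm (word_op U w x) = rnorm x.
Proof. by move=> Uu; elim: w => //= j w <-; exact: unitary_isometric. Qed.

Lemma word_op_surjective H (U : 'I_d -> {linear H -> H}) w y :
  (forall j, unitary_op (U j)) -> exists x, word_op U w x = y.
Proof.
move=> Uu; elim: w y => [|j w IHw] y; first by exists y.
have [x wx] := IHw (adjoint (U j) y); exists x; rewrite /= wx.
by have [_ _ /(congr1 (@^~ y))] := Uu j.
Qed.

End Words.

(** * Canonical pseudo-extensions *)

Section Canonical.
Variables (R : realType) (H K : hilbertType R) (d : nat).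
Variables (T : 'I_d -> {linear H -> H}) (U : 'I_d -> {linear K -> K}).
Variable J : {linear H -> K}.

(** [product_op T] is a mere function; here it gets the structure that the
    adjoint calculus needs. *)
Lemma product_op_bounded_linear (X : H -> H) : (forall j, bounded_op (T j)) ->
  (forall j, X \o T j = T j \o X) ->
  exists P : {linear H -> H},
    [/\ product_op T = P, bounded_op P & X \o P = P \o X].
Proof.
move=> Tb XT; rewrite /product_op.
apply: (big_ind (fun A : H -> H => exists P : {linear H -> H},
    [/\ A = P, bounded_op P & X \o P = P \o X])).
- exists (idfun : {linear H -> H}); split=> //.
  by apply/bounded_opP; exists 1 => x; rewrite mul1r.
- move=> _ _ [P [-> /bounded_opP[M PM] XP]] [Q [-> /bounded_opP[N QN] XQ]].
  exists (P \o Q : {linear H -> H}); split=> //.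
    apply/bounded_opP; exists (`|M| * `|N|) => x /=.
    apply: le_trans (PM _) _; rewrite -mulrA.
    apply: le_trans (ler_wpM2r (rnorm_ge0 _) (ler_norm M)) _.
    rewrite ler_wpM2l//; apply: le_trans (QN _) _.
    by apply: ler_wpM2r; [exact: rnorm_ge0|exact: ler_norm].
  by rewrite compA XP -compA XQ compA.
- by move=> j _; exists (T j); split.
Qed.

Lemma rdot_iter_adjoint (P : {linear H -> H}) n x y : bounded_op P ->
  rdot (iter n P x) y = rdot x (iter n (adjoint P) y).
Proof.
move=> Pb; elim: n y => //= n IHn y.
by rewrite rdot_adjoint// IHn -iterS iterSr.
Qed.

(** The squared norms of [P^n h] and [J h] are the quadratic forms of
    [P^*n P^n] and [J^* J] at [h]. *)
Lemma canonical_sqr_rnorm_cvg h :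
  bounded_op J -> (forall j, bounded_op (T j)) ->
  sot_cvg (fun n => iter n (adjoint (product_op T)) \o iter n (product_op T))
    (adjoint J \o J) ->
  forall e : R, 0 < e -> \forall n \near \oo,
    `|rnorm (iter n (product_op T) h) ^+ 2 - rnorm (J h) ^+ 2| <= e * rnorm h.
Proof.
move=> Jb Tb /(_ h)/cvgrPdistC_lt cvg e e0.
have [P [PE Pb _]] := product_op_bounded_linear Tb
  (fun j => erefl : idfun \o T j = T j \o idfun).
have := cvg e%:C; rewrite ltcR => /(_ e0); apply: filterS => n.
rewrite PE /= rnormE ltcR => /ltW small.
rewrite -!rdotxx rdot_iter_adjoint// rdot_adjoint// -rdotNr -rdotDr.
by apply: le_trans (rdot_abs_le _ _) _; rewrite mulrC ler_wpM2r ?rnorm_ge0.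
Qed.

(** The key estimate: [|P^n X h| = |X P^n h| <= |X| |P^n h|], and both norms
    converge, to [|J X h|] and [|J h|]. *)
Lemma canonical_commutant_le (X : {linear H -> H}) h :
  bounded_op J -> (forall j, bounded_op (T j)) ->
  sot_cvg (fun n => iter n (adjoint (product_op T)) \o iter n (product_op T))
    (adjoint J \o J) ->
  commutant T X -> rnorm (J (X h)) <= opnorm X * rnorm (J h).
Proof.
move=> Jb Tb cvg [Xb XT].
have [P [PE Pb XP]] := product_op_bounded_linear Tb XT.
have XPn n : iter n P (X h) = X (iter n P h).
  by elim: n => //= n ->; have /(congr1 (@^~ (iter n P h))) := XP.
have c0 := opnorm_ge0 Xb.
rewrite -ler_sqr ?nnegrE ?mulr_ge0 ?rnorm_ge0// exprMn -subr_le0.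
apply: (@le0_of_small R _ (rnorm (X h) + opnorm X ^+ 2 * rnorm h)) => e e0.
have [n []] := filter_ex (filterI
  (canonical_sqr_rnorm_cvg h Jb Tb cvg e0)
  (canonical_sqr_rnorm_cvg (X h) Jb Tb cvg e0)).
rewrite PE XPn !ler_norml => /andP[_ E1] /andP[E2 _].
have := le_opnorm (iter n P h) Xb.
rewrite -ler_sqr ?nnegrE ?mulr_ge0 ?rnorm_ge0// exprMn => E3.
have := ler_wpM2l (sqr_ge0 (opnorm X)) E1; lra.
Qed.

(** The closure of [D] is reducing: invariance of [D] under the adjoints gives
    invariance of the orthogonal complement, and all operators involved are
    isometric, so invariance passes to closures. *)
Lemma minimal_dense (D : set K) :
  minimal_pseudo_extension T J U -> (forall j, unitary_op (U j)) ->
  (forall a x y, D x -> D y -> D (a *: x + y)) ->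
  (forall j x, D x -> D (U j x)) -> (forall j x, D x -> D (adjoint (U j) x)) ->
  (forall h, D (J h)) -> dense D.
Proof.
move=> [_ Jmin] Uu Dlin DU DUs DJ x; apply/closure_rnormP.
suff -> : closure D = setT by [].
apply: Jmin.
- split; first exact: closed_closure.
    by apply: subset_closure; rewrite -(linear0 J); exact: DJ.
  move=> a u v /closure_rnormP Du /closure_rnormP Dv.
  apply/closure_rnormP => e e0.
  have b0 : 0 <= complex.Re `|a| by rewrite -ler0c RRe_real ?normr_real.
  have b1 : 0 < 2 * (complex.Re `|a| + 1) by rewrite mulr_gt0// ltr_wpDl.
  have [|u' Du' uu'] := Du (e / (2 * (complex.Re `|a| + 1))).
    by rewrite divr_gt0.
  have [|v' Dv' vv'] := Dv (e / 2); first by rewrite divr_gt0.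
  exists (a *: u' + v'); first exact: Dlin.
  rewrite opprD addrACA -scalerBr; apply: le_lt_trans (rnormD _ _) _.
  rewrite rnormZ; move: uu'; rewrite ltr_pdivlMr//.
  have := rnorm_ge0 (u' - u); nra.
- move=> j; have Uadj u : U j (adjoint (U j) u) = u.
    by have [_ _ /(congr1 (@^~ u))] := Uu j.
  split=> [_ [u /closure_rnormP Du <-]|_ [u uD <-] v /closure_rnormP Dv].
    apply/closure_rnormP => e e0; have [u' Du' uu'] := Du e e0.
    by exists (U j u'); [exact: DU|rewrite -linearB unitary_isometric].
  have [Ub _ _] := Uu j.
  rewrite adjointP//; apply: uD; apply/closure_rnormP => e e0.
  have [v' Dv' vv'] := Dv e e0; exists (adjoint (U j) v'); first exact: DUs.
  by rewrite -(unitary_isometric _ (Uu j)) linearB !Uadj.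
- by move=> _ [h _ <-]; apply: subset_closure; exact: DJ.
Qed.

End Canonical.

Theorem theorem3p1 (R : realType) (H K : hilbertType R) (d : nat)
    (T : 'I_d -> {linear H -> H})
    (J : {linear H -> K}) (U : 'I_d -> {linear K -> K}) :
  commuting_tuple T ->
  (forall j, contractive_op (T j)) ->
  canonical_unitary_pseudo_extension T J U ->
  forall X : {linear H -> H}, commutant T X ->
  exists Y : {linear K -> K},
    [/\ commutant U Y, J \o X = Y \o J & opnorm Y <= opnorm X].
Proof.
move=> [Tb TT] _ [[Jmin Jcvg] Uu] X XT.
have [[[Ub UU] [Jb _] _ JT] _] := Jmin.
have [Xb XTj] := XT.
have JTE j h : J (T j h) = U j (J h) by have /(congr1 (@^~ h)) := JT j.
have XTE j h : X (T j h) = T j (X h) by have /(congr1 (@^~ h)) := XTj j.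
have UUE i j k : U i (U j k) = U j (U i k).
  by have /(congr1 (@^~ k)) := UU i j.
have UwU w j k : U j (word_op U w k) = word_op U w (U j k).
  by apply: word_op_intertwine => i x; exact: UUE.
have UwUw w v k : word_op U w (word_op U v k) = word_op U v (word_op U w k).
  by apply: word_op_intertwine => i x; rewrite UwU.
have JTw w h : J (word_op T w h) = word_op U w (J h).
  exact: word_op_intertwine.
have XTw w h : X (word_op T w h) = word_op T w (X h).
  exact: word_op_intertwine.
have Uadj j k : U j (adjoint (U j) k) = k.
  by have [_ _ /(congr1 (@^~ k))] := Uu j.
pose G k k' := exists w h, word_op U w k = J h /\ word_op U w k' = J (X h).
have Gtotal w h k : word_op U w k = J h -> exists k', G k k'.
  move=> kh; have [k' k'h] := word_op_surjective w (J (X h)) Uu.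
  by exists k', w, h.
have Glin (a : R[i]) x x' y y' : G x y -> G x' y' ->
    G (a *: x + x') (a *: y + y').
  move=> [w [h [xh yh]]] [v [g [xg yg]]].
  (* Commutation of the [U_j] gives [U_(v ++ w) = U_v U_w = U_w U_v]; this
     common word serves both pairs. *)
  exists (v ++ w), (a *: word_op T v h + word_op T w g).
  rewrite !word_op_cat !word_op_linear xh yh !(UwUw v w) xg yg.
  by rewrite !linearP !XTw !JTw.
have Gle x y : G x y -> rnorm y <= opnorm X * rnorm x.
  move=> [w [h [xh yh]]].
  rewrite -(word_op_isometric w x Uu) -(word_op_isometric w y Uu) xh yh.
  exact: canonical_commutant_le Jcvg XT.
have GU j x y : G x y -> G (U j x) (U j y).
  move=> [w [h [xh yh]]]; exists w, (T j h).
  by rewrite -!UwU xh yh XTE !JTE.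
have Gdense : dense [set x | exists y, G x y].
  apply: minimal_dense Jmin Uu _ _ _ _.
  - by move=> a x x' [y Gxy] [y' Gxy']; exists (a *: y + y'); exact: Glin.
  - by move=> j x [y Gxy]; exists (U j y); exact: GU.
  - move=> j x [y [w [h [xh _]]]]; apply: (Gtotal (j :: w) h).
    by rewrite /= UwU Uadj.
  - by move=> h; exact: (Gtotal [::] h).
have [Y [YG Yle]] := extend_linear_relation (opnorm_ge0 Xb) Glin Gle Gdense.
have Yb : bounded_op Y by apply/bounded_opP; exists (opnorm X).
exists Y; split.
- split=> // j; apply/funext.
  apply: (eq_on_dense (A := Y \o U j) (B := U j \o Y) _ _ Gdense).
  + apply/bounded_opP; exists (opnorm X) => x /=.
    by rewrite -(unitary_isometric x (Uu j)).
  + by apply/bounded_opP; exists (opnorm X) => x /=; rewrite unitary_isometric.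
  + by move=> x [y Gxy] /=; rewrite (YG _ _ Gxy) (YG _ _ (GU j _ _ Gxy)).
- by apply/funext => h /=; apply/esym/YG; exists [::], h.
- exact: opnorm_le (opnorm_ge0 Xb) Yle.
Qed.
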